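(* Let $X$ and $Y$ be (nonempty) countable crowded Hausdorff topological spaces. Then the product space $X \times Y$ is maximally resolvable.
   Context: A topological space is crowded if it has no isolated points. For a nonempty topological space $Z$, the dispersion character is $\Delta(Z) = \min\{|U| : U \text{ is a nonempty open subset of } Z\}$. For a cardinal $\kappa$, a space $Z$ is $\kappa$-resolvable if $Z$ can be partitioned into $\kappa$-many (pairwise disjoint) dense subsets. A space $Z$ is maximally resolvable if it is $\Delta(Z)$-resolvable. *)

(* Defs.v *)
From mathcomp Require Import all_boot all_order all_algebra.
From mathcomp Require Import boolp classical_sets functions cardinality topology.

Set Implicit Arguments.
Unset Strict Implicit.
Unset Printing Implicit Defensive.

Local Open Scope classical_set_scope.
Local Open Scope card_scope.

Definition crowded (Z : topologicalType) : Prop :=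
  isolated [set: Z] = set0.

(* Cardinals are represented by sets up to equipotence [#=], so "kappa" below
   is any set having the intended cardinality. *)
Definition is_dispersion_character (Z : topologicalType) (I : Type)
    (kappa : set I) : Prop :=
  (exists U : set Z, [/\ open U, U !=set0 & U #= kappa]) /\
  (forall U : set Z, open U -> U !=set0 -> kappa #<= U).

(* The partition is given as a family of subsets indexed by itself;
   [partition] requires its blocks to be nonempty. *)
Definition resolvable (Z : topologicalType) (I : Type) (kappa : set I) : Prop :=
  exists P : set (set Z),
    [/\ P #= kappa, partition P id [set: Z] & forall D, P D -> dense D].

(* The dispersion character is attained by a subset of Z, so a representative
   can be sought among the subsets of Z; it is unique up to equipotence. *)
Definition maximally_resolvable (Z : topologicalType) : Prop :=
  exists kappa : set Z, is_dispersion_character Z kappa /\ resolvable Z kappa.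

Lemma is_dispersion_character_unique (Z : topologicalType) (I J : Type)
    (kappa : set I) (lambda : set J) :
  is_dispersion_character Z kappa -> is_dispersion_character Z lambda ->
  kappa #= lambda.
Proof.
move=> [[U [oU U0 Uk]] kmin] [[V [oV V0 Vl]] lmin].
rewrite card_eq_le -(card_le_eqr Vl) -(card_le_eqr Uk).
by rewrite kmin// lmin.
Qed.

Lemma resolvable_card_eq (Z : topologicalType) (I J : Type)
    (kappa : set I) (lambda : set J) :
  kappa #= lambda -> resolvable Z kappa -> resolvable Z lambda.
Proof.
by move=> kl [P [Pk partP dP]]; exists P; split=> //; exact: card_eq_trans kl.
Qed.

(* Main.v *)
Require Import Defs.
From mathcomp Require Import all_boot all_order all_algebra.
From mathcomp Require Import boolp classical_sets functions cardinality topology.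

(**
A nonempty open subset of [X * Y] turns out to be countably infinite, so the
task is to split [X * Y] into countably many dense classes.

Each point [z] of a factor is given a finite set [C z] of natural numbers so
that arbitrarily close to [z], and for arbitrarily large [N], there are points
[w] with [C w] equal to [C z] below [N] and nonempty from [N] on
([limit_marking]).  For the rationals, seen as the finitely supported points of
the Cantor space, [C z] would be the set of positions of the digits 1 of [z].
Given marks [C] on [X] and [D] on [Y], scan the naturals in increasing order,
looking alternately for an element of [C x] and for an element of [D y]; let
[T (x, y)] be the number of finds.  If [T (x, y) = t], then moving only the
coordinate whose mark is awaited, inside a given neighbourhood and with [N]
beyond both marks, keeps the first [t] finds and adds exactly one: the other
mark is exhausted ([settles_at_next]).  Hence [T] takes all large enough values
on every nonempty open set, and composing [T] with a map from nat to nat whose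
fibres are all infinite gives the dense classes.

Such marks are read off a sequence of finer and finer finite partitions of [Z]
which separates points and all of whose cells are crowded.  The Hausdorff
property provides countably many open sets [U n] such that any [x <> y] satisfy
[x \in U n] and [y \notin closure (U n)] for some [n].  Since [Z] may well be
connected, cells cannot be expected to be open; what survives is that each open
set meets a cell in no point or in more than one.  This persists when a cell [Q]
is cut into the points of [Q] in [closure (U n `&` Q)] and the others
([code_crowded]).  Fixing an injection of [Z] into nat, [C z] collects the
levels at which the cell of [z] loses its least point, which happens only
finitely often and must happen late for points [w <> z] that share a small cell
with [z].
*)

Set Implicit Arguments.
Unset Strict Implicit.
Unset Printing Implicit Defensive.

Local Open Scope classical_set_scope.
Local Open Scope card_scope.

(** * Crowded partitions separating the points of a countable Hausdorff space *)

Lemma crowded_nbhs (Z : topologicalType) (z : Z) (A : set Z) :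
  crowded Z -> nbhs z A -> exists2 w, A w & w <> z.
Proof.
move=> crZ zA; apply: contrapT => no_w.
suff : isolated [set: Z] z by rewrite crZ.
split; first exact: in_setT.
exists A => //; rewrite setIT; apply/seteqP; split => [w Aw|_ ->] /=.
  by apply: contrapT => wz; apply: no_w; exists w.
exact: nbhs_singleton.
Qed.

Lemma exists_separating_opens (Z : topologicalType) :
  countable [set: Z] -> hausdorff_space Z ->
  exists U : nat -> set Z, (forall n, open (U n)) /\
    (forall x y, x <> y -> exists n, U n x /\ ~ closure (U n) y).
Proof.
move=> cZ; rewrite open_hausdorff => hZ.
have /countable_injP[idx idx_inj] : countable [set: Z * Z].
  by rewrite -setXTT; exact: countableX.
have /choice[S SP] (q : Z * Z) : exists A : set Z, open A /\
    (q.1 <> q.2 -> A q.1 /\ ~ closure A q.2).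
  have [|/eqP/hZ[[A B] /= [/set_mem Aq /set_mem Bq] [oA oB /eqP AB]]] :=
    EM (q.1 = q.2); first by exists set0; split=> //; exact: open0.
  exists A; split=> // _; split=> // /(_ B (open_nbhs_nbhs (conj oB Bq))).
  by rewrite AB => -[].
(* The union has at most one term: it turns a family indexed by pairs of
   points into a sequence. *)
exists (fun n => \bigcup_(q in [set q | idx q = n]) S q); split=> [n|x y xy].
  by apply: bigcup_open => q _; exact: (SP q).1.
have [Sx Sy] := (SP (x, y)).2 xy.
exists (idx (x, y)); suff -> :
    \bigcup_(q in [set q | idx q = idx (x, y)]) S q = S (x, y) by [].
rewrite (_ : [set q | _] = [set (x, y)]) ?bigcup_set1//.
apply/seteqP; split=> [q /= qxy|q /= ->//].
by apply: idx_inj; rewrite ?in_setT.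
Qed.

Section ClosureCode.
Variables (Z : topologicalType) (U : nat -> set Z).

(** [code n] names the cells of the level-[n] partition: the new bit cuts each
    cell [Q] along the closure of [U n `&` Q], rather than of [U n], so that
    [U n `&` Q] stays dense in the part of [Q] that it is sent to. *)
Fixpoint code n (z : Z) : seq bool :=
  if n is m.+1 then
    rcons (code m z) `[< closure (U m `&` [set w | code m w = code m z]) z >]
  else [::].

Lemma codeS_inj n x y : code n.+1 x = code n.+1 y -> code n x = code n y.
Proof. by move=> /rcons_inj[]. Qed.

Lemma code_le m n x y : m <= n -> code n x = code n y -> code m x = code m y.
Proof.
move=> /subnK <-; elim: (n - m) => [//|k IH].
by rewrite addSn => /codeS_inj.
Qed.

Lemma code_separates x y n : U n x -> ~ closure (U n) y ->
  code n.+1 x <> code n.+1 y.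
Proof.
move=> Ux clUy /rcons_inj[_ bits]; apply: clUy.
apply: (closureS (@subIsetl _ (U n) [set w | code n w = code n y])).
by apply/asboolP; rewrite -bits; apply/asboolP; exact: subset_closure.
Qed.

(** By induction on the level.  If the cell [Q] of [z] was cut and [z] lies in
    [closure (U n `&` Q)], neighbourhoods of [z] contain points of [U n `&` Q],
    which all carry the bit of [z]; the only such point could be [z] itself, but
    then [U n] is a neighbourhood of [z] and the induction hypothesis applies
    inside it.  Otherwise a neighbourhood of [z] avoids [U n `&` Q], and the
    points of [Q] there carry the same bit as [z]. *)
Lemma code_crowded n (z : Z) (A : set Z) :
  (forall m, open (U m)) -> crowded Z -> nbhs z A ->
  exists w : Z, [/\ A w, w <> z & code n w = code n z].
Proof.
move=> oU crZ; elim: n A => [|n IH] A zA.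
  by have [w Aw wz] := crowded_nbhs crZ zA; exists w.
have [clz|clz] :=
    EM (closure (U n `&` [set w | code n w = code n z]) z); last first.
  have [N zN NU0] : exists2 N, open_nbhs z N &
      ~ ((U n `&` [set w | code n w = code n z]) `&` N !=set0).
    move: clz; rewrite /closure /= => /existsNP[B /not_implyP[]].
    rewrite nbhsE => -[N zN NB] UB0; exists N => //.
    by move=> -[w [Uw Nw]]; apply: UB0; exists w; split=> //; exact: NB.
  have [w [[Aw Nw] wz wz_code]] := IH _ (filterI zA (open_nbhs_nbhs zN)).
  exists w; split=> //=; rewrite wz_code; congr rcons.
  rewrite (asboolF clz); apply: asboolF => clw; apply: NU0; apply: clw.
  by apply: open_nbhs_nbhs; split=> //; exact: zN.1.
suff [w [Aw wz Uw wz_code]] :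
    exists w, [/\ A w, w <> z, U n w & code n w = code n z].
  exists w; split=> //=; rewrite wz_code (asboolT clz) asboolT//.
  exact: subset_closure.
have [w [[Uw wz_code] Aw]] := clz _ zA.
have [wz|] := EM (w = z); last by exists w.
rewrite wz in Uw; have zUA : nbhs z (U n `&` A).
  by apply: filterI => //; apply: open_nbhs_nbhs.
by have [v [[Uv Av] vz vz_code]] := IH _ zUA; exists v.
Qed.

End ClosureCode.

(** * Finite marks growing along limits *)

(** The marks of points close to [z] end-extend the mark of [z], with a gap that
    can be prescribed. *)
Definition limit_marking (Z : topologicalType) (C : Z -> nat -> bool) :=
  (forall z, exists N, forall n, N <= n -> ~~ C z n) /\
  (forall z A N, nbhs z A -> exists w, [/\ A w,
     forall n, n < N -> C w n = C z n & exists2 n, N <= n & C w n]).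

(** [n] belongs to the mark of [z] when the level-[n] cell of [z] contains a
    point smaller than all those of its level-[n.+1] cell.  This depends on the
    cells of [z] up to level [n.+1] only, and fails once [z] is the least point
    of its cell.  If [w <> z] shares with [z] a cell of which [z] is the least
    point, the level where they part is in the mark of [w], [z] itself being
    the witness. *)
Lemma exists_limit_marking (Z : topologicalType) :
  countable [set: Z] -> crowded Z -> hausdorff_space Z ->
  exists C : Z -> nat -> bool, limit_marking C.
Proof.
move=> cZ crZ hZ; have [U [oU sepU]] := exists_separating_opens cZ hZ.
have /countable_injP[idx idxI] := cZ.
have idx_inj x y : idx x = idx y -> x = y by apply: idxI; exact: in_setT.
have code_separated x y : x <> y -> exists n, code U n x <> code U n y.
  by move=> /sepU[n [Uw clz]]; exists n.+1; exact: code_separates.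
have isolate z : exists N, forall w, code U N w = code U N z -> idx z <= idx w.
  suff [N NP] : exists N, forall w, idx w < idx z -> w <> z ->
      code U N w <> code U N z.
    exists N => w wz; rewrite leqNgt; apply/negP => lt_wz.
    by apply: (NP w lt_wz) => // eq_wz; rewrite eq_wz ltnn in lt_wz.
  elim: (idx z) => [|k [N NP]]; first by exists 0.
  have [[v [vk vz]]|no_v] := EM (exists v, idx v = k /\ v <> z); last first.
    exists N => w; rewrite ltnS leq_eqVlt => /orP[/eqP wk wz|/NP//].
    by exfalso; apply: no_v; exists w.
  have [M vM] := code_separated _ _ vz.
  exists (maxn N M) => w; rewrite ltnS leq_eqVlt => /orP[/eqP wk|wk] wz.
    have -> : w = v by apply: idx_inj; rewrite wk.
    by move=> /(code_le (leq_maxr N M)).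
  by move=> /(code_le (leq_maxl N M)); exact: NP.
pose C z n := `[< exists w, code U n w = code U n z /\
  forall v, code U n.+1 v = code U n.+1 z -> idx w < idx v >].
exists C; split=> [z|z A N zA].
  have [N NP] := isolate z; exists N => n Nn; apply/asboolP => -[w [wz lt_w]].
  have := lt_w z erefl; rewrite ltnNge => /negP; apply.
  by apply: NP; exact: code_le wz.
have [M MP] := isolate z; pose L := maxn M N.
have [w [Aw wz wzL]] := code_crowded L oU crZ zA.
exists w; split=> // [n nN|].
  have nL : n < L by rewrite leq_max nN orbT.
  by rewrite /C (code_le nL wzL) (code_le (ltnW nL) wzL).
have [n [Ln nz nSz]] : exists n, [/\ L <= n, code U n w = code U n z &
    code U n.+1 w <> code U n.+1 z].
  have [k0 wk0] := code_separated _ _ wz.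
  have ex_k : exists k, code U k w != code U k z by exists k0; apply/eqP.
  case: (ex_minnP ex_k) => -[|n] /eqP wk k_min; first by [].
  exists n; split=> //.
    by rewrite -ltnS ltnNge; apply/negP => nL; apply: wk; exact: code_le wzL.
  by apply/eqP/negPn/negP => /k_min; rewrite ltnn.
exists n; first exact: leq_trans (leq_maxr M N) Ln.
apply/asboolP; exists z; split=> // v vw.
rewrite ltn_neqAle; apply/andP; split.
  by apply/eqP => /idx_inj zv; apply: nSz; rewrite -vw -zv.
apply: MP; apply: (@code_le _ _ _ n).
  exact: leq_trans (leq_maxl M N) Ln.
by rewrite -nz; exact: codeS_inj vw.
Qed.

(** * Counting alternations *)

(** The parity of the count selects which of the two sets [s false], [s true]
    is awaited, so no other state is needed. *)
Fixpoint alternations (s : bool -> nat -> bool) n :=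
  if n is m.+1 then
    alternations s m + s (odd (alternations s m)) m
  else 0.

Definition settles_at s t := exists N, forall n, N <= n -> alternations s n = t.

Lemma settles_at_uniq s t t' : settles_at s t -> settles_at s t' -> t = t'.
Proof.
move=> [N Nt] [N' Nt'].
by rewrite -(Nt (maxn N N')) ?leq_maxl// Nt'// leq_maxr.
Qed.

Lemma alternations_const s N n : N <= n ->
  (forall m, N <= m < n -> ~~ s (odd (alternations s N)) m) ->
  alternations s n = alternations s N.
Proof.
move=> /subnK <-; elim: (n - N) => [//|k IH] sN.
rewrite addSn /= IH => [|m /andP[Nm mk]]; last first.
  by apply: sN; rewrite Nm addSn ltnS ltnW.
by rewrite (negbTE (sN _ _)) ?addn0// leq_addl addSn ltnS leqnn.
Qed.

Lemma eq_alternations s s' N :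
  (forall b n, n < N -> s' b n = s b n) -> alternations s' N = alternations s N.
Proof.
elim: N => [//|N IH] ss' /=; rewrite ss'// IH// => b n nN.
by rewrite ss'// ltnW.
Qed.

Lemma settles_at_exists s N : (forall b n, N <= n -> ~~ s b n) ->
  exists t, settles_at s t.
Proof.
move=> sN; exists (alternations s N), N => n Nn.
by apply: alternations_const => // m /andP[Nm _]; exact: sN.
Qed.

(** Both scans have count [t] at [N].  The first element of [s' (odd t)] from
    there on raises it to [t.+1], after which the
    scan waits for ever for an element of the other set. *)
Lemma settles_at_next s s' N t :
    (forall n, N <= n -> alternations s n = t) ->
    (forall b n, n < N -> s' b n = s b n) ->
    (exists2 n, N <= n & s' (odd t) n) ->
    (forall n, N <= n -> ~~ s' (~~ odd t) n) ->
  settles_at s' t.+1.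
Proof.
move=> st ss' [n0 Nn0 sn0] other.
have altN : alternations s' N = t by rewrite (eq_alternations ss') st.
have ex_n : exists n, (N <= n) && s' (odd t) n by exists n0; rewrite Nn0.
case: (ex_minnP ex_n) => n /andP[Nn sn] n_min.
have altn : alternations s' n = t.
  rewrite -altN; apply: alternations_const => // m /andP[Nm mn].
  rewrite altN; apply/negP => sm.
  by have := n_min m; rewrite Nm sm leqNgt mn => /(_ isT).
have altnS : alternations s' n.+1 = t.+1 by rewrite /= altn sn addn1.
exists n.+1 => m nm; rewrite -altnS; apply: alternations_const => // k.
move=> /andP[nk _]; rewrite altnS; apply: other.
exact: leq_trans Nn (ltnW nk).
Qed.

(** * Dense classes in the product *)

Section Product.
Variables (X Y : topologicalType).
Variables (C : X -> nat -> bool) (D : Y -> nat -> bool).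
Hypotheses (C_marking : limit_marking C) (D_marking : limit_marking D).

Definition marks (p : X * Y) (b : bool) : nat -> bool :=
  if b then D p.2 else C p.1.

Lemma marks_settle p : exists t, settles_at (marks p) t.
Proof.
have [N NP] := C_marking.1 p.1; have [M MP] := D_marking.1 p.2.
apply: (@settles_at_exists _ (maxn N M)) => -[] n; rewrite geq_max => /andP[??].
  exact: MP.
exact: NP.
Qed.

Lemma open_settles_next (O : set (X * Y)) p t : open O -> O p ->
  settles_at (marks p) t -> exists2 q, O q & settles_at (marks q) t.+1.
Proof.
case: p => x y oO Op [N Nt].
have [[A B] /= [xA yB] AB] : nbhs (x, y) O by exact: open_nbhs_nbhs.
have [Nx NxP] := C_marking.1 x; have [Ny NyP] := D_marking.1 y.
pose L := maxn N (maxn Nx Ny).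
have Lt n : L <= n -> alternations (marks (x, y)) n = t.
  by move=> Ln; apply: Nt; exact: leq_trans (leq_maxl _ _) Ln.
have [LNx LNy] : Nx <= L /\ Ny <= L by rewrite !leq_max !leqnn !orbT.
case odd_t: (odd t).
- have [w [Bw wy [n Ln Dw]]] := D_marking.2 y B L yB.
  exists (x, w); first by apply: AB; split=> //=; exact: nbhs_singleton.
  apply: (settles_at_next Lt) => [[] m mL /=||m Lm]; rewrite ?odd_t //=.
  + exact: wy.
  + by exists n.
  + by apply: NxP; exact: leq_trans Lm.
- have [w [Aw wx [n Ln Cw]]] := C_marking.2 x A L xA.
  exists (w, y); first by apply: AB; split=> //=; exact: nbhs_singleton.
  apply: (settles_at_next Lt) => [[] m mL /=||m Lm]; rewrite ?odd_t //=.
  + exact: wx.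
  + by exists n.
  + by apply: NyP; exact: leq_trans Lm.
Qed.

Lemma open_settles_ge (O : set (X * Y)) : open O -> O !=set0 ->
  exists t0, forall t, t0 <= t -> exists2 q, O q & settles_at (marks q) t.
Proof.
move=> oO [p Op]; have [t0 pt0] := marks_settle p; exists t0 => t /subnK <-.
elim: (t - t0) => [|k [q Oq qt]]; first by exists p.
by rewrite addSn; exact: open_settles_next qt.
Qed.

(** [fun t => logn 2 t.+1] takes each value at arbitrarily large [t]. *)
Definition color_class (c : nat) : set (X * Y) :=
  [set p | exists2 t, settles_at (marks p) t & logn 2 t.+1 = c].

Lemma color_class_dense c : dense (color_class c).
Proof.
move=> O O0 oO; have [t0 t0P] := open_settles_ge oO O0.
(* The factor [3 ^ t0] makes the count exceed [t0] without changing the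
   2-adic valuation. *)
have t_gt0 : 0 < 2 ^ c * 3 ^ t0 by rewrite muln_gt0 !expn_gt0.
have [|q Oq qt] := t0P (2 ^ c * 3 ^ t0).-1.
  rewrite -ltnS prednK// (leq_trans (ltn_expl t0 (isT : 1 < 3)))//.
  by rewrite leq_pmull// expn_gt0.
exists q; split=> //; exists (2 ^ c * 3 ^ t0).-1; rewrite ?prednK//.
by rewrite mulnC logn_Gauss ?pfactorK// coprimeXr.
Qed.

Lemma color_class_uniq c d p : color_class c p -> color_class d p -> c = d.
Proof. by move=> [t pt <-] [t' /(settles_at_uniq pt) <-]. Qed.

Lemma color_class_cover p : exists c, color_class c p.
Proof. by have [t pt] := marks_settle p; exists (logn 2 t.+1), t. Qed.

End Product.

(** Infinitely many disjoint dense classes already make each nonempty open set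
    infinite, hence equipotent to nat, so the dispersion character is that of the
    whole space. *)
Lemma maximally_resolvable_dense_classes (Z : topologicalType)
    (K : nat -> set Z) :
  countable [set: Z] -> [set: Z] !=set0 -> (forall c, dense (K c)) ->
  (forall c d z, K c z -> K d z -> c = d) -> (forall z, exists c, K c z) ->
  maximally_resolvable Z.
Proof.
move=> cZ Z0 dK uK covK.
have K0 c : K c !=set0 by have [z [_ ?]] := dK c _ Z0 openT; exists z.
have K_inj : injective K.
  by move=> c d cd; have [z Kz] := K0 c; apply: (uK c d z) => //; rewrite -cd.
have card_open (O : set Z) : open O -> O !=set0 -> O #= [set: nat].
  move=> oO O0; apply: eq_card_nat.
    by apply: sub_countable cZ; exact: subset_card_le.
  apply/infiniteP.
  have /choice[h hP] c : exists z, O z /\ K c z.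
    by have [z []] := dK c O O0 oO; exists z.
  have h_inj : injective h.
    move=> c d cd; have [_ Kc] := hP c; have [_ Kd] := hP d.
    by rewrite -cd in Kd; exact: uK Kc Kd.
  rewrite -(card_le_eql (inj_card_eq (in2W h_inj))).
  by apply: subset_card_le => _ [c _ <-]; exact: (hP c).1.
have cardT := card_open _ openT Z0.
exists [set: Z]; split; first split.
- by exists [set: Z]; split=> //; exact: openT.
- move=> O oO O0; have := card_open _ oO O0.
  by move=> /card_esym/(card_eq_trans cardT); rewrite card_eq_le => /andP[].
exists (range K); split.
- apply: card_eq_trans (card_esym cardT).
  exact: inj_card_eq (in2W K_inj).
- split.
  + apply/seteqP; split=> // z _; have [c Kz] := covK z.
    by exists (K c) => //; exists c.
  + by move=> _ _ [c _ <-] [d _ <-] [z [/uK Kc /Kc <-]].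
  + by move=> _ [c _ <-].
- by move=> _ [c _ <-].
Qed.

Theorem theorem2p1 (X Y : topologicalType)
    (X_nonempty : [set: X] !=set0) (Y_nonempty : [set: Y] !=set0)
    (X_countable : countable [set: X]) (Y_countable : countable [set: Y])
    (X_crowded : crowded X) (Y_crowded : crowded Y)
    (X_hausdorff : hausdorff_space X) (Y_hausdorff : hausdorff_space Y) :
  maximally_resolvable (X * Y)%type.
Proof.
have [C C_marking] := exists_limit_marking X_countable X_crowded X_hausdorff.
have [D D_marking] := exists_limit_marking Y_countable Y_crowded Y_hausdorff.
have [[x _] [y _]] := (X_nonempty, Y_nonempty).
apply: (@maximally_resolvable_dense_classes _ (color_class C D)).
- by rewrite -setXTT; exact: countableX.
- by exists (x, y).
- exact: color_class_dense.
- exact: color_class_uniq.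
- exact: color_class_cover.
Qed.
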